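(* Let $m\ge 0$ be an integer and let $\mathcal{C}_m$ be the set of all partitions (including the empty one) in which each even part appears at most $2m+1$ times. Then, as formal power series in $q$ with coefficients polynomials in $x$, $$\sum_{\lambda\in\mathcal{C}_m} x^{l_a(\lambda)}q^{|\lambda|}=\sum_{\mu\in\mathcal{C}_m} x^{l_o(\mu)}q^{|\mu|}=\frac{(-xq;q^2)_{\infty}(q^{4m+4};q^{4m+4})_{\infty}}{(q^2;q^2)_{\infty}(x^2q^2;q^4)_{\infty}}.$$
   Context: For a partition $\lambda=(\lambda_1\ge\lambda_2\ge\cdots\ge\lambda_r>0)$: $|\lambda|=\sum_i\lambda_i$; $l_a(\lambda)=\lambda_1-\lambda_2+\lambda_3-\cdots$ is the alternating sum; $l_o(\lambda)$ is the number of odd parts counted with multiplicity. $(a;q)_\infty=\prod_{i\ge0}(1-aq^i)$. *)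

(* Defs.v *)
From HB Require Import structures.
From mathcomp Require Import all_boot all_order all_algebra.
From mathcomp Require Import finmap.
From mathcomp Require Import boolp classical_sets functions cardinality fsbigop.

Set Implicit Arguments.
Unset Strict Implicit.
Unset Printing Implicit Defensive.

Import Order.TTheory GRing.Theory Num.Theory.

Local Open Scope classical_set_scope.
Local Open Scope ring_scope.

(* The ring R[[q]]. A record is used rather than an alias of nat -> R, because
   the latter carries the pointwise product. *)
Record fps (R : Type) : Type := Fps { fcoef : nat -> R }.

Notation "'{fps' R }" := (fps R) (at level 0, R at level 2, format "'{fps'  R }")
  : type_scope.

Notation "f @_ n" := (fcoef f n) (at level 3, n at level 2,
  left associativity, format "f @_ n")
  : ring_scope.

HB.instance Definition _ (R : Type) := gen_eqMixin {fps R}.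
HB.instance Definition _ (R : Type) := gen_choiceMixin {fps R}.

Lemma fpsP (R : Type) (f g : {fps R}) : (forall n, f@_n = g@_n) <-> f = g.
Proof.
split=> [|->//]; case: f g => f [g] /= fg.
by congr Fps; apply/funext.
Qed.

Section FpsRing.
Variable R : comNzRingType.
Implicit Types f g h : {fps R}.

Definition fps_zero : {fps R} := Fps (fun=> 0).
Definition fps_opp f : {fps R} := Fps (fun n => - f@_n).
Definition fps_add f g : {fps R} := Fps (fun n => f@_n + g@_n).

Fact fps_addA : associative fps_add.
Proof. by move=> f g h; apply/fpsP => n /=; rewrite addrA. Qed.
Fact fps_addC : commutative fps_add.
Proof. by move=> f g; apply/fpsP => n /=; rewrite addrC. Qed.
Fact fps_add0 : left_id fps_zero fps_add.
Proof. by move=> f; apply/fpsP => n /=; rewrite add0r. Qed.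
Fact fps_addN : left_inverse fps_zero fps_opp fps_add.
Proof. by move=> f; apply/fpsP => n /=; rewrite addNr. Qed.

HB.instance Definition _ :=
  GRing.isZmodule.Build {fps R} fps_addA fps_addC fps_add0 fps_addN.

Definition fpsC (c : R) : {fps R} := Fps (fun n => if n == 0%N then c else 0).
Definition fpsX : {fps R} := Fps (fun n => (n == 1%N)%:R).
Definition fps_mul f g : {fps R} :=
  Fps (fun n => \sum_(i < n.+1) f@_i * g@_(n - i)).

Fact fps_mulC : commutative fps_mul.
Proof.
move=> f g; apply/fpsP => n /=; rewrite (reindex_inj rev_ord_inj) /=.
by apply: eq_bigr => i _; rewrite subSS (subKn (leq_ord i)) mulrC.
Qed.

Fact fps_mulA : associative fps_mul.
Proof.
have rev f g n : (fps_mul f g)@_n = \sum_(i < n.+1) f@_(n - i) * g@_i.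
  by rewrite fps_mulC /=; apply: eq_bigr => i _; rewrite mulrC.
move=> p q r; apply/fpsP => i; rewrite [RHS]rev.
pose coef3 j k := p@_j * (q@_(i - j - k) * r@_k).
transitivity (\sum_(j < i.+1) \sum_(k < i.+1 | (k <= i - j)%N) coef3 j k).
  apply: eq_bigr => j _; rewrite rev big_distrr /=.
  by rewrite (big_ord_narrow_leq (leq_subr _ _)).
rewrite (exchange_big_dep predT) //=; apply: eq_bigr => k _.
transitivity (\sum_(j < i.+1 | (j <= i - k)%N) coef3 j k).
  apply: eq_bigl => j; rewrite -ltnS -(ltnS j) -!subSn ?leq_ord //.
  by rewrite -subn_gt0 -(subn_gt0 j) -!subnDA addnC.
rewrite (big_ord_narrow_leq (leq_subr _ _)) big_distrl /=.
by apply: eq_bigr => j _; rewrite /coef3 -!subnDA addnC mulrA.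
Qed.

Fact fps_mul1 : left_id (fpsC 1) fps_mul.
Proof.
move=> f; apply/fpsP => n /=; rewrite big_ord_recl /= mul1r subn0.
by rewrite big1 ?addr0 // => i _; rewrite mul0r.
Qed.

Fact fps_mulDl : left_distributive fps_mul fps_add.
Proof.
move=> f g h; apply/fpsP => n /=; rewrite -big_split.
by apply: eq_bigr => i _; rewrite mulrDl.
Qed.

Fact fps_one_neq0 : fpsC 1 != 0.
Proof.
by apply/eqP => /fpsP /(_ 0%N) /= /eqP; rewrite (negPf (oner_neq0 R)).
Qed.

HB.instance Definition _ :=
  GRing.Zmodule_isComNzRing.Build {fps R}
    fps_mulA fps_mulC fps_mul1 fps_mulDl fps_one_neq0.

(* The inverse is chosen classically; fps_unit_coef0 below shows that every
   series with constant coefficient 1 has one. *)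
Definition fps_unit : {pred {fps R}} := fun f => `[< exists g, g * f = 1 >].
Definition fps_inv f : {fps R} := xget f [set g | g * f = 1].

Fact fps_mulVf : {in fps_unit, left_inverse 1 fps_inv *%R}.
Proof. by move=> f /asboolP fU; exact: (xgetPex f fU). Qed.

Fact fps_unitPl f g : g * f = 1 -> fps_unit f.
Proof. by move=> gf; apply/asboolP; exists g. Qed.

Fact fps_invr_out : {in [predC fps_unit], fps_inv =1 id}.
Proof.
move=> f /asboolPn fU; rewrite /fps_inv; case: xgetP => // g _ gf.
by case: fU; exists g.
Qed.

HB.instance Definition _ :=
  GRing.ComNzRing_hasMulInverse.Build {fps R}
    fps_mulVf fps_unitPl fps_invr_out.

Lemma fcoef0 n : (0 : {fps R})@_n = 0. Proof. by []. Qed.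
Lemma fcoef1 n : (1 : {fps R})@_n = (n == 0%N)%:R.
Proof. by rewrite /=; case: eqP. Qed.
Lemma fcoefD f g n : (f + g)@_n = f@_n + g@_n. Proof. by []. Qed.
Lemma fcoefN f n : (- f)@_n = - f@_n. Proof. by []. Qed.
Lemma fcoefM f g n :
  (f * g)@_n = \sum_(i < n.+1) f@_i * g@_(n - i).
Proof. by []. Qed.
Lemma fcoef0M f g : (f * g)@_0 = f@_0 * g@_0.
Proof. by rewrite fcoefM big_ord1. Qed.

Lemma fcoef_exp_small f k n : f@_0 = 0 -> (n < k)%N -> (f ^+ k)@_n = 0.
Proof.
move=> f0; elim: k n => // k IHk n lt_nk; rewrite exprS fcoefM big1 // => i _.
have [->|i_gt0] := posnP i; first by rewrite f0 mul0r.
have n_gt0 : (0 < n)%N by rewrite (leq_trans i_gt0) // leq_ord.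
rewrite IHk ?mulr0 //; apply: (@leq_trans n) => //.
by rewrite ltn_subrL i_gt0.
Qed.

Lemma fps_unit_coef0 f : f@_0 = 1 -> f \is a GRing.unit.
Proof.
move=> f0; pose u := 1 - f.
have u0 : u@_0 = 0 by rewrite fcoefD fcoefN f0 fcoef1 subrr.
pose S N := \sum_(k < N) u ^+ k.
have stabS n N : (n < N)%N -> (S N)@_n = (S n.+1)@_n.
  elim: N => // N IHN; rewrite ltnS leq_eqVlt => /predU1P[-> //|lt_nN].
  by rewrite /S big_ord_recr fcoefD fcoef_exp_small // addr0 IHN.
pose g : {fps R} := Fps (fun n => (S n.+1)@_n).
apply/asboolP; exists g; apply/fpsP => n.
have -> : (g * f)@_n = (S n.+1 * f)@_n.
  rewrite !fcoefM; apply: eq_bigr => i _; congr (_ * _).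
  by rewrite [LHS]/= -(stabS i n.+1).
have -> : S n.+1 * f = 1 - u ^+ n.+1.
  have -> : f = 1 - u by rewrite /u opprB addrC subrK.
  by rewrite mulrC -opprB mulNr -subrX1 opprB.
by rewrite fcoefD fcoefN (fcoef_exp_small u0) // subr0.
Qed.

End FpsRing.

(* Coefficientwise sum of a family; meaningful when, for each n, only finitely
   many members of the family have a nonzero n-th coefficient. *)
Definition fps_sum (R : comNzRingType) (I : choiceType) (A : set I)
    (F : I -> {fps R}) : {fps R} :=
  Fps (fun n => \sum_(i \in A) (F i)@_n).

Notation "\fps_sum_ ( i '\in' A ) F" := (fps_sum A (fun i => F))
  (at level 41, F at level 41, i, A at level 60,
   format "'[' \fps_sum_ ( i  '\in'  A ) '/  '  F ']'") : ring_scope.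

(* Limit for the q-adic topology: every coefficient is eventually constant. *)
Definition fps_cvg (R : Type) (u : nat -> {fps R}) (f : {fps R}) : Prop :=
  forall n, exists N, forall k, (N <= k)%N -> (u k)@_n = f@_n.

Definition fps_lim (R : comNzRingType) (u : nat -> {fps R}) : {fps R} :=
  xget 0 [set f | fps_cvg u f].

Lemma fps_cvg_unique (R : Type) (u : nat -> {fps R}) (f g : {fps R}) :
  fps_cvg u f -> fps_cvg u g -> f = g.
Proof.
move=> uf ug; apply/fpsP => n; have [N uN] := uf n; have [M uM] := ug n.
by rewrite -(uN (maxn N M)) ?leq_maxl // uM ?leq_maxr.
Qed.

Lemma fps_cvg_lim (R : comNzRingType) (u : nat -> {fps R}) (f : {fps R}) :
  fps_cvg u f -> fps_lim u = f.
Proof.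
move=> uf; apply: (fps_cvg_unique _ uf).
exact: (xgetPex 0 (ex_intro [set f | fps_cvg u f] f uf)).
Qed.

(* (a; Q)_n and (a; Q)_oo *)
Definition qpoch (R : comNzRingType) (a Q : {fps R}) (n : nat) : {fps R} :=
  \prod_(i < n) (1 - a * Q ^+ i).

Lemma qpochS (R : comNzRingType) (a Q : {fps R}) (n : nat) :
  qpoch a Q n.+1 = qpoch a Q n * (1 - a * Q ^+ n).
Proof. by rewrite /qpoch big_ord_recr. Qed.

Definition qpoch_inf (R : comNzRingType) (a Q : {fps R}) : {fps R} :=
  fps_lim (qpoch a Q).

Lemma qpoch_cvg (R : comNzRingType) (a Q : {fps R}) :
  Q@_0 = 0 -> fps_cvg (qpoch a Q) (qpoch_inf a Q).
Proof.
move=> Q0; have stab n k : (n < k)%N -> (qpoch a Q k)@_n = (qpoch a Q n.+1)@_n.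
  elim: k => // k IHk; rewrite ltnS leq_eqVlt => /predU1P[-> //|lt_nk].
  rewrite -(IHk lt_nk) qpochS mulrBr mulr1 fcoefD fcoefN mulrA fcoefM big1 ?subr0 // => i _.
  by rewrite (fcoef_exp_small Q0) ?mulr0 // (leq_ltn_trans (leq_subr _ _)).
have cv : fps_cvg (qpoch a Q) (Fps (fun n => (qpoch a Q n.+1)@_n)).
  by move=> n; exists n.+1 => k; exact: stab.
by rewrite /qpoch_inf (fps_cvg_lim cv).
Qed.

Lemma qpoch_inf_unit (R : comNzRingType) (a Q : {fps R}) :
  a@_0 = 0 -> Q@_0 = 0 -> qpoch_inf a Q \is a GRing.unit.
Proof.
move=> a0 Q0; apply: fps_unit_coef0; have [N /(_ N (leqnn N)) <-] := qpoch_cvg a Q0 0.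
elim: N => [|N IHN]; first by rewrite /qpoch big_ord0.
by rewrite qpochS fcoef0M IHN mul1r fcoefD fcoefN fcoef0M a0 mul0r subr0.
Qed.

Local Open Scope nat_scope.

Definition is_partition (l : seq nat) : bool :=
  sorted geq l && all (leq 1) l.

(* l1 - (l2 - (l3 - ...)); the truncated subtractions are exact on partitions,
   see alt_sumE. *)
Fixpoint alt_sum (l : seq nat) : nat :=
  if l is a :: l' then a - alt_sum l' else 0.

Definition odd_parts (l : seq nat) : nat := count odd l.

Lemma alt_sumE (l : seq nat) : is_partition l ->
  ((alt_sum l)%:Z = \sum_(i < size l) (-1) ^+ i * (nth 0%N l i)%:Z)%R.
Proof.
have ub a s : path geq a s -> alt_sum s <= a.
  case: s => //= b s /andP[le_ba _]; exact: leq_trans (leq_subr _ _) le_ba.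
case/andP => + _; elim: l => [|a l IHl] sl; first by rewrite big_ord0.
rewrite big_ord_recl /= expr0 mul1r -subzn ?ub // IHl ?(path_sorted sl) //.
rewrite -sumrN; congr (_ + _)%R.
by apply: eq_bigr => i _; rewrite exprS mulN1r mulNr.
Qed.

Definition Cset (m : nat) : set (seq nat) :=
  [set l | is_partition l /\
           forall k, ~~ odd k -> count_mem k l <= 2 * m + 1].

Lemma finite_partitions (n : nat) :
  finite_set [set l | is_partition l /\ sumn l = n].
Proof.
pose F (t : n.-bseq 'I_n.+1) := [seq val i | i <- t].
apply: (@sub_finite_set _ _ (F @` setT)); last exact/finite_image/finite_finset.
move=> l [/andP[_ l_pos] sl].
have szl : size l <= n.
  rewrite -{}sl; elim: l l_pos => //= a l IHl /andP[a_pos /IHl sz_l].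
  by rewrite -add1n leq_add.
have ltl : all (fun i => i < n.+1) l.
  apply/allP => i il; rewrite ltnS -sl.
  elim: l il {l_pos sl szl} => //= a l IHl; rewrite inE => /predU1P[->|/IHl].
    exact: leq_addr.
  by move=> /leq_trans; apply; exact: leq_addl.
have szb : size [seq inord i : 'I_n.+1 | i <- l] <= n by rewrite size_map.
exists (Bseq szb) => //; rewrite /F /= -map_comp map_id_in // => i il /=.
by rewrite inordK // (allP ltl).
Qed.

Local Open Scope ring_scope.

Lemma fcoefCM (R : comNzRingType) (c : R) (f : {fps R}) (n : nat) :
  (fpsC c * f)@_n = c * f@_n.
Proof.
rewrite fcoefM big_ord_recl subn0 big1 ?addr0 // => i _.
by rewrite [X in X * _]/= mul0r.
Qed.

Lemma fpsCX (R : comNzRingType) (c : R) (k : nat) : fpsC c ^+ k = fpsC (c ^+ k).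
Proof.
elim: k => // k IHk; rewrite exprS IHk; apply/fpsP => n.
by rewrite fcoefCM /= exprS; case: eqP; rewrite ?mulr0.
Qed.

Lemma fcoefXn (R : comNzRingType) (k n : nat) :
  (fpsX R ^+ k)@_n = (n == k)%:R.
Proof.
elim: k n => [|k IHk] n; first exact: fcoef1.
rewrite exprS fcoefM; case: n => [|n]; first by rewrite big_ord1 mul0r.
rewrite 2!big_ord_recl [fcoef _ _]/= mul0r add0r [fcoef _ _]/= mul1r subSS subn0.
rewrite IHk eqSS big1 ?addr0 // => i _.
by rewrite [X in X * _]/= mul0r.
Qed.

Lemma Cset_summable (m : nat) (e : seq nat -> nat) (n : nat) :
  finite_set (Cset m `&`
    [set l | (fpsC ('X : {poly int}) ^+ e l * fpsX {poly int} ^+ sumn l)@_n != 0]).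
Proof.
apply: sub_finite_set (finite_partitions n) => l [[lP _]].
rewrite /mkset fpsCX fcoefCM fcoefXn; case: (n =P sumn l) => [-> //|_].
by rewrite mulr0 eqxx.
Qed.

(* Main.v *)
Require Import Defs.
From mathcomp Require Import all_boot all_order all_algebra.
From mathcomp Require Import boolp classical_sets functions fsbigop.
From mathcomp Require Import zify ring.

(** For the odd-part statistic the generating function factors over part sizes,
    and the even part [k] contributes [(1 - q^(k(2m+2))) / (1 - q^k)].

    For the alternating sum, equal parts cancel in pairs. Hence writing each
    multiplicity as [2g + d] with [d <= 1] splits off a factor depending only on
    the [g]'s, and capping the multiplicities of even parts at [2m+1] multiplies
    the generating function of all partitions by
    [H = (q^(4m+4); q^(4m+4))_oo]. The odd-part generating function acquires the
    same factor [H], so it suffices to compare the two statistics on all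
    partitions, where conjugation exchanges them: [l_a] counts the columns of
    odd length. *)

Set Implicit Arguments.
Unset Strict Implicit.
Unset Printing Implicit Defensive.

Import GRing.Theory.

Local Open Scope nat_scope.

(** * Conjugation of partitions *)

(** Conjugating [a :: l] adds one to the first [a] parts of the conjugate of [l], padded with zeros.
    Entries of [s] past the first [a] are dropped, whence the hypotheses [size s <= a] below. *)
Fixpoint add_col (a : nat) (s : seq nat) : seq nat :=
  if a is a'.+1 then (head 0 s).+1 :: add_col a' (behead s) else [::].

Fixpoint conj_part (l : seq nat) : seq nat :=
  if l is a :: l' then add_col a (conj_part l') else [::].

Lemma size_add_col a s : size (add_col a s) = a.
Proof. by elim: a s => //= a IHa s; rewrite IHa. Qed.

Lemma sumn_add_col a s : size s <= a -> sumn (add_col a s) = a + sumn s.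
Proof.
elim: a s => [|a IHa] [|b s] //= sz; rewrite IHa //=; lia.
Qed.

(** The added column flips the parity of [a] entries, the padding zeros counting as even. *)
Lemma odd_parts_add_col a s :
  size s <= a -> odd_parts (add_col a s) = a - odd_parts s.
Proof.
suff D : size s <= a -> odd_parts (add_col a s) + odd_parts s = a.
  by move=> sz; rewrite -{2}(D sz) addnK.
elim: a s => [|a IHa] [|b s] //= sz.
  by have := IHa [::] isT; rewrite /odd_parts /=; lia.
have := IHa s sz; rewrite /odd_parts /=; case: (odd b) => /=; lia.
Qed.

Lemma is_partition_add_col a s :
  sorted geq s -> is_partition (add_col a s).
Proof.
rewrite /is_partition => ss; apply/andP; split; last by elim: a s {ss} => /=.
elim: a s ss => // -[//|a] IHa s ss.
have bs : sorted geq (behead s) by case: s ss => //= b s /path_sorted.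
move: (IHa _ bs) => /= ->; rewrite andbT.
by case: s ss {bs} => [|b [|c s]] //= /andP[].
Qed.

Lemma is_partition_cons a l : is_partition (a :: l) ->
  [/\ is_partition l, head 0 l <= a & 0 < a].
Proof.
rewrite /is_partition /= => /andP[pl /andP[a_gt0 ->]].
rewrite (path_sorted pl) a_gt0; split=> //.
by case: l pl => //= b l /andP[].
Qed.

Lemma size_conj_part l : size (conj_part l) = head 0 l.
Proof. by case: l => //= a l; rewrite size_add_col. Qed.

Lemma is_partition_conj l : is_partition l -> is_partition (conj_part l).
Proof.
elim: l => //= a l IHl /is_partition_cons[lP _ _].
by apply: is_partition_add_col; have /andP[] := IHl lP.
Qed.

(** Induction step of [conj_partK]: conjugation turns the new column back into a part. *)
Lemma conj_part_add_col a s :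
  0 < a -> size s <= a -> conj_part (add_col a s) = a :: conj_part s.
Proof.
elim: a s => // -[_|a IHa] s _ sz; first by case: s sz => [|b []].
rewrite -[LHS]/(add_col (head 0 s).+1 (conj_part (add_col a.+1 (behead s)))).
by rewrite IHa //; case: s sz.
Qed.

Lemma conj_partK l : is_partition l -> conj_part (conj_part l) = l.
Proof.
elim: l => //= a l IHl /is_partition_cons[lP la a_gt0].
by rewrite conj_part_add_col ?size_conj_part // IHl.
Qed.

Lemma sumn_conj_part l : is_partition l -> sumn (conj_part l) = sumn l.
Proof.
elim: l => //= a l IHl /is_partition_cons[lP la _].
by rewrite sumn_add_col ?size_conj_part // IHl.
Qed.

(* Both sides obey the recursion [v (a :: l) = a - v l]. *)
Lemma odd_parts_conj_part l :
  is_partition l -> odd_parts (conj_part l) = alt_sum l.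
Proof.
elim: l => //= a l IHl /is_partition_cons[lP la _].
by rewrite odd_parts_add_col ?size_conj_part // IHl.
Qed.

(** * Partitions with bounded parts and multiplicities *)

Lemma alt_sum_le_head l : alt_sum l <= head 0 l.
Proof. by case: l => //= a l; rewrite leq_subr. Qed.

Lemma alt_sum_nseq_cat j k l : alt_sum l <= k ->
  alt_sum (nseq j k ++ l) = if odd j then k - alt_sum l else alt_sum l.
Proof.
by move=> le_lk; elim: j => //= j ->; case: (odd j) => //=; rewrite subKn.
Qed.

(** The cap on the multiplicity of a part [k] is the odd number [2 * b k + 1], so the allowed
    multiplicities are exactly [2g + d] with [g <= b k] and [d <= 1]. *)
Fixpoint bparts (b : nat -> nat) (N : nat) : seq (seq nat) :=
  if N is N'.+1
  then [seq nseq j N ++ l | j <- iota 0 (b N).*2.+2, l <- bparts b N']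
  else [:: [::]].

Lemma count_mem_nseq_cat (j k i : nat) (l : seq nat) :
  count_mem i (nseq j k ++ l) = (k == i) * j + count_mem i l.
Proof. by rewrite count_cat count_nseq. Qed.

Lemma count_mem_gt (N k : nat) (l : seq nat) :
  all (geq N) l -> N < k -> count_mem k l = 0.
Proof.
move=> lN Nk; apply/count_memPn/negP => /(allP lN) /=; lia.
Qed.

Lemma head_le_all N l : all (geq N) l -> head 0 l <= N.
Proof. by case: l => //= a l /andP[]. Qed.

Lemma is_partition_nseq_cat j k l : 0 < k -> is_partition l ->
  all (geq k) l -> is_partition (nseq j k ++ l).
Proof.
move=> k_gt0 /andP[sl pl] lk; rewrite /is_partition all_cat pl andbT.
apply/andP; split; last by elim: j => //= j ->; rewrite k_gt0.
elim: j => //= j; case: j => /= [_|j ->]; last by rewrite leqnn.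
by case: l sl lk {pl} => //= c l -> /andP[->].
Qed.

Lemma partition_nseq_cat k l : is_partition l -> all (geq k) l ->
  exists j s, [/\ l = nseq j k ++ s, is_partition s & all (geq k.-1) s].
Proof.
elim: l => [_ _|a l IHl]; first by exists 0, [::].
move=> alP /= /andP[ak lk]; have [lP la a_gt0] := is_partition_cons alP.
have [ea|nea] := eqVneq a k.
  by have [j [s [-> sP sk]]] := IHl lP lk; exists j.+1, s; rewrite ea.
exists 0, (a :: l); split=> //=.
have -> /= : a <= k.-1 by lia.
have : all (geq a) l.
  by case/andP: alP => /= pl _; move: pl; rewrite path_sortedE; [case/andP|];
    move=> // x y z xy /leq_trans; apply.
by apply: sub_all => i /=; lia.
Qed.

Lemma mem_bparts b N l :
  reflect [/\ is_partition l, all (geq N) l &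
              forall k, 0 < k <= N -> count_mem k l <= (b k).*2.+1]
          (l \in bparts b N).
Proof.
elim: N l => [|N IHN] l; apply: (iffP idP).
- by rewrite inE => /eqP->; split=> // k; lia.
- by case: l => // a l [/andP[_ /= /andP[a_gt0 _]]] /andP[] /=; lia.
- case/allpairsP=> -[j s] [+ /IHN[sP sN sb] ->].
  rewrite mem_iota add0n => /= jb.
  have sN1 : all (geq N.+1) s by apply: sub_all sN => i /= /leqW.
  split; first exact: is_partition_nseq_cat.
    by rewrite all_cat sN1 andbT; apply/allP=> i /nseqP[->] /=.
  move=> k; rewrite count_mem_nseq_cat; have [<- _|neq kN] := eqVneq.
    by rewrite (count_mem_gt sN) //; lia.
  by rewrite mul0n sb //; lia.
- case=> lP lN lb; have [j [s [el sP sN]]] := partition_nseq_cat lP lN.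
  apply/allpairsP; exists (j, s); split=> //.
    have := lb N.+1 (leqnn _).
    by rewrite el count_mem_nseq_cat eqxx (count_mem_gt sN) // mem_iota /=; lia.
  apply/IHN; split=> // k /andP[k_gt0 kN]; have := lb k.
  by rewrite el count_mem_nseq_cat k_gt0 leqW // => /(_ isT);
    apply: leq_trans (leq_addl _ _).
Qed.

Lemma uniq_bparts b N : uniq (bparts b N).
Proof.
elim: N => // N IHN; apply: allpairs_uniq => //; first exact: iota_uniq.
move=> [i s] [j t] /allpairsP[[i' s'] [_ s'N [-> ->]]].
move=> /allpairsP[[j' t'] [_ t'N [-> ->]]] /= E.
have /mem_bparts[_ sN _] := s'N; have /mem_bparts[_ tN _] := t'N.
(* All parts of [s'] and [t'] are at most [N], so counting [N.+1] recovers the number of prepended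
   copies. *)
have := congr1 (count_mem N.+1) E.
rewrite !count_mem_nseq_cat eqxx !mul1n.
rewrite (count_mem_gt sN) // (count_mem_gt tN) // !addn0 => eij.
by move: E; rewrite eij => /eqP; rewrite eqseq_cat // eqxx => /eqP->.
Qed.

Lemma sumn_nseq_cat j k l : sumn (nseq j k ++ l) = k * j + sumn l.
Proof. by rewrite sumn_cat sumn_nseq. Qed.

Lemma odd_parts_nseq_cat j k l :
  odd_parts (nseq j k ++ l) = odd k * j + odd_parts l.
Proof. by rewrite /odd_parts count_cat count_nseq. Qed.

Local Open Scope ring_scope.

(** * Generating functions of bounded partitions *)

Lemma sum_double (V : nmodType) (f : nat -> V) n :
  \sum_(j < n.*2) f j = \sum_(g < n) (f g.*2 + f g.*2.+1).
Proof.
by elim: n => [|n IHn]; rewrite ?big_ord0 // doubleS !big_ord_recr /= IHn addrA.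
Qed.

Lemma prod_double (R : pzSemiRingType) (f : nat -> R) n :
  \prod_(j < n.*2) f j = \prod_(g < n) (f g.*2 * f g.*2.+1).
Proof.
by elim: n => [|n IHn]; rewrite ?big_ord0 // doubleS !big_ord_recr /= IHn mulrA.
Qed.

Lemma geometric_sum (R : comPzRingType) (y : R) n :
  (\sum_(j < n) y ^+ j) * (1 - y) = 1 - y ^+ n.
Proof. by rewrite mulrC -opprB mulNr -subrX1 opprB. Qed.

Section BoundedGeneratingFunctions.
Variables (R : comNzRingType) (x q : R).
Implicit Type b : nat -> nat.

Definition odd_gf b N : R :=
  \sum_(l <- bparts b N) x ^+ odd_parts l * q ^+ sumn l.
Definition alt_gf b N : R :=
  \sum_(l <- bparts b N) x ^+ alt_sum l * q ^+ sumn l.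
(* Prepending an odd number of parts [N] turns [alt_sum l] into
   [N - alt_sum l]; tracking both closes the recursion on [N]. *)
Definition coalt_gf b N : R :=
  \sum_(l <- bparts b N) x ^+ (N - alt_sum l) * q ^+ sumn l.

Definition part_wt k : R := x ^+ odd k * q ^+ k.

(** The numerators left when each truncated geometric series in the weight of a part is summed in
    closed form. *)
Definition cap_prod b N : R :=
  \prod_(i < N) (1 - part_wt i.+1 ^+ (b i.+1).*2.+2).

Lemma big_bpartsS b N (F : seq nat -> R) :
  \sum_(l <- bparts b N.+1) F l =
  \sum_(j < (b N.+1).*2.+2) \sum_(l <- bparts b N) F (nseq j N.+1 ++ l).
Proof.
rewrite [bparts _ _]/(allpairs_dep _ _ _) big_allpairs_dep.
by rewrite -(big_mkord xpredT (fun j => \sum_(l <- _) F (nseq j N.+1 ++ l)))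
  /index_iota subn0.
Qed.

(** Multiplicities of distinct parts are independent and both statistics are additive, so [odd_gf]
    is a product of truncated geometric series. *)
Lemma odd_gfE b N :
  odd_gf b N * \prod_(i < N) (1 - part_wt i.+1) = cap_prod b N.
Proof.
elim: N => [|N IHN].
  by rewrite /odd_gf /cap_prod big_seq1 !big_ord0 !expr0 !mulr1.
rewrite /cap_prod !big_ord_recr /= -/(cap_prod b N) -IHN -geometric_sum.
suff -> : odd_gf b N.+1 =
    (\sum_(j < (b N.+1).*2.+2) part_wt N.+1 ^+ j) * odd_gf b N by ring.
rewrite /odd_gf big_bpartsS mulr_suml; apply: eq_bigr => j _.
rewrite mulr_sumr; apply: eq_bigr => l _.
rewrite odd_parts_nseq_cat sumn_nseq_cat /part_wt exprMn -!exprM !exprD.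
by ring.
Qed.

Lemma alt_sum_bparts b N l : l \in bparts b N -> (alt_sum l <= N)%N.
Proof.
case/mem_bparts=> _ lN _; apply: leq_trans (alt_sum_le_head l) _.
exact: head_le_all.
Qed.

(* Equal parts cancel in pairs, so the multiplicity of the largest part
   matters for the alternating sum only through its parity. *)
Lemma alt_gfS b N : alt_gf b N.+1 =
  (\sum_(g < (b N.+1).+1) (q ^+ N.+1.*2) ^+ g) *
  (alt_gf b N + x * q ^+ N.+1 * coalt_gf b N).
Proof.
rewrite /alt_gf big_bpartsS -doubleS
  (sum_double (fun j => \sum_(l <- bparts b N)
     x ^+ alt_sum (nseq j N.+1 ++ l) * q ^+ sumn (nseq j N.+1 ++ l))).
rewrite mulr_suml; apply: eq_bigr => g _.
rewrite mulrDr !mulr_sumr; congr (_ + _); rewrite !big_seq;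
  apply: eq_bigr => l /alt_sum_bparts lN; have lN1 := leqW lN;
  rewrite alt_sum_nseq_cat // sumn_nseq_cat /= odd_double /=.
  by rewrite exprD -mul2n mulnCA mul2n doubleMl exprM; ring.
rewrite subSn // exprS exprD -exprM.
have -> : (N.+1 * g.*2.+1 = N.+1.*2 * g + N.+1)%N by lia.
by rewrite exprD; ring.
Qed.

(** An even number of copies of [N.+1] raises the complement [N - alt_sum l] by one; an odd number
    turns it back into [alt_sum l]. *)
Lemma coalt_gfS b N : coalt_gf b N.+1 =
  (\sum_(g < (b N.+1).+1) (q ^+ N.+1.*2) ^+ g) *
  (x * coalt_gf b N + q ^+ N.+1 * alt_gf b N).
Proof.
rewrite /coalt_gf big_bpartsS -doubleS
  (sum_double (fun j => \sum_(l <- bparts b N)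
     x ^+ (N.+1 - alt_sum (nseq j N.+1 ++ l)) * q ^+ sumn (nseq j N.+1 ++ l))).
rewrite mulr_suml; apply: eq_bigr => g _.
rewrite mulrDr !mulr_sumr; congr (_ + _); rewrite !big_seq;
  apply: eq_bigr => l /alt_sum_bparts lN; have lN1 := leqW lN;
  rewrite alt_sum_nseq_cat // sumn_nseq_cat /= odd_double /=.
  by rewrite subSn // exprS exprD -mul2n mulnCA mul2n doubleMl exprM; ring.
rewrite subKn // exprD -exprM.
have -> : (N.+1 * g.*2.+1 = N.+1.*2 * g + N.+1)%N by lia.
by rewrite exprD; ring.
Qed.

End BoundedGeneratingFunctions.

(** At [x = 1] the new factor contains the very geometric sum that multiplies the recursions of
    [alt_gf] and [coalt_gf]. *)
Lemma cap_prod1S (R : comNzRingType) (q : R) b N :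
  cap_prod 1 q b N.+1 = cap_prod 1 q b N *
    ((\sum_(g < (b N.+1).+1) (q ^+ N.+1.*2) ^+ g) * (1 - q ^+ N.+1.*2)).
Proof.
rewrite geometric_sum /cap_prod big_ord_recr /= /part_wt expr1n mul1r.
by rewrite -!exprM -doubleS -doubleMr -doubleMl.
Qed.

(* The recursion matrices for [b] and [b'] are proportional. *)
Lemma alt_gf_cap_prod (R : comNzRingType) (x q : R) b b' N :
  alt_gf x q b N * cap_prod 1 q b' N = alt_gf x q b' N * cap_prod 1 q b N.
Proof.
suff [] : alt_gf x q b N * cap_prod 1 q b' N =
            alt_gf x q b' N * cap_prod 1 q b N /\
          coalt_gf x q b N * cap_prod 1 q b' N =
            coalt_gf x q b' N * cap_prod 1 q b N by [].
elim: N => [|N [IHa IHc]].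
  by rewrite /alt_gf /coalt_gf /cap_prod !big_seq1 !big_ord0.
rewrite !cap_prod1S !alt_gfS !coalt_gfS.
set E := \sum_(g < _) _; set E' := \sum_(g < (b' _).+1) _.
move: (1 - _) (q ^+ N.+1) => t y.
split; [transitivity (E * E' * t * (alt_gf x q b N * cap_prod 1 q b' N +
    x * y * (coalt_gf x q b N * cap_prod 1 q b' N))); first by ring
  | transitivity (E * E' * t * (x * (coalt_gf x q b N * cap_prod 1 q b' N) +
    y * (alt_gf x q b N * cap_prod 1 q b' N))); first by ring];
  by rewrite IHa IHc; ring.
Qed.

Local Open Scope classical_set_scope.

(** * Limits of formal power series *)

Section Limits.
Variable R : comNzRingType.
Implicit Types (f g : {fps R}) (u v : nat -> {fps R}).

Lemma fps_cvg_le u f : fps_cvg u f ->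
  forall n, exists N, forall k i, (N <= k)%N -> (i <= n)%N -> (u k)@_i = f@_i.
Proof.
move=> uf; elim=> [|n [N uN]].
  by have [N uN] := uf 0%N; exists N => k [|//] Nk _; exact: uN.
have [N' uN'] := uf n.+1; exists (maxn N N') => k i.
rewrite geq_max => /andP[Nk N'k]; rewrite leq_eqVlt.
case/predU1P=> [->|]; first exact: uN'.
by rewrite ltnS; exact: uN.
Qed.

Lemma fps_cvgM u v f g :
  fps_cvg u f -> fps_cvg v g -> fps_cvg (fun k => u k * v k) (f * g).
Proof.
move=> /fps_cvg_le uf /fps_cvg_le vg n.
have [N uN] := uf n; have [N' vN'] := vg n.
exists (maxn N N') => k; rewrite geq_max => /andP[Nk N'k].
rewrite !fcoefM; apply: eq_bigr => i _.
by rewrite uN ?vN' ?leq_subr // -ltnS.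
Qed.

Lemma eq_fps_lim u v f g :
  u =1 v -> fps_cvg u f -> fps_cvg v g -> f = g.
Proof. by move=> /funext->; exact: fps_cvg_unique. Qed.

Lemma fcoef_sum (I : Type) (r : seq I) (F : I -> {fps R}) n :
  (\sum_(i <- r) F i)@_n = \sum_(i <- r) (F i)@_n.
Proof. by elim/big_rec2: _ => // i y z _ <-. Qed.

Lemma fcoef_mul_exp_small f g k n :
  g@_0 = 0 -> (n < k)%N -> (f * g ^+ k)@_n = 0.
Proof.
move=> g0 nk; rewrite fcoefM big1 // => i _.
by rewrite fcoef_exp_small ?mulr0 // (leq_ltn_trans (leq_subr _ _)).
Qed.

(** Each factor is 1 modulo [q ^+ M], hence so is the product, however many factors it has. *)
Lemma fps_cvg_prod1 (q : {fps R}) (s : nat -> nat) (F : nat -> nat -> {fps R}) :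
  q@_0 = 0 -> fps_cvg (fun M => \prod_(i < s M) (1 - F M i * q ^+ M)) 1.
Proof.
move=> q0 n; exists n.+1 => M nM; elim: (s M) => [|k IHk].
  by rewrite big_ord0.
rewrite big_ord_recr [X in X@_n]/= mulrBr mulr1 fcoefD fcoefN mulrA.
rewrite fcoef_mul_exp_small //.
by rewrite subr0 IHk.
Qed.

End Limits.

(** * Generating functions of capped partitions as limits *)

(** The even numbers as [E] give [Cset m]; [pred0] gives all partitions. *)
Definition capped_parts (E : pred nat) (m : nat) : set (seq nat) :=
  [set l | is_partition l /\ forall k, E k -> (count_mem k l <= 2 * m + 1)%N].

(* The bound [2 * M + 1] on the remaining multiplicities disappears
   as [M] grows. *)
Definition cap (E : pred nat) (m M k : nat) : nat := if E k then m else M.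

Lemma size_le_sumn l : is_partition l -> (size l <= sumn l)%N.
Proof.
elim: l => //= a l IHl /is_partition_cons[/IHl lP _ a_gt0]; lia.
Qed.

Lemma all_geq_sumn l : all (geq (sumn l)) l.
Proof.
elim: l => //= a l IHl; rewrite leq_addr /=.
by apply: sub_all IHl => i /= il; apply: leq_trans il (leq_addl _ _).
Qed.

Lemma bparts_capped E m M l :
  l \in bparts (cap E m M) M.*2 -> capped_parts E m l.
Proof.
case/mem_bparts=> lP lM lb; split=> // k Ek.
have [->|k_gt0] := posnP k.
  suff -> : count_mem 0%N l = 0%N by [].
  by apply/count_memPn/negP => /(allP (proj2 (andP lP))).
have [kM|Mk] := leqP k M.*2; last by rewrite (count_mem_gt lM).
by have := lb k; rewrite k_gt0 kM /cap Ek => /(_ isT); lia.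
Qed.

Lemma capped_bparts E m M l : capped_parts E m l -> (sumn l <= M)%N ->
  l \in bparts (cap E m M) M.*2.
Proof.
case=> lP lE lM; apply/mem_bparts; split=> //.
  by apply: sub_all (all_geq_sumn l) => i /=; lia.
move=> k _; rewrite /cap; case: ifP => [/lE|_]; first by lia.
apply: leq_trans (count_size _ _) (leq_trans (size_le_sumn lP) _); lia.
Qed.

Section CappedGeneratingFunctions.
Variables (R : comNzRingType) (x : {fps R}).
Let q : {fps R} := fpsX R.

(** A partition of size at most [M] has parts and multiplicities at most [M], so the auxiliary
    bounds do not affect coefficients up to degree [M]. *)
Lemma bparts_gf_cvg E m (e : seq nat -> nat) :
  fps_cvg (fun M => \sum_(l <- bparts (cap E m M) M.*2) x ^+ e l * q ^+ sumn l)
          (\fps_sum_(l \in capped_parts E m) (x ^+ e l * q ^+ sumn l)).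
Proof.
move=> n; exists n => M nM; rewrite fcoef_sum /=.
have F0 l : ~ (sumn l <= n)%N -> (x ^+ e l * q ^+ sumn l)@_n = 0.
  by move=> /negP; rewrite -ltnNge; exact: fcoef_mul_exp_small.
transitivity (\sum_(l \in capped_parts E m `&` [set l | (sumn l <= n)%N])
                (x ^+ e l * q ^+ sumn l)@_n).
  apply/esym/fsbig_fwiden; last 1 first.
  - move=> l [/= /bparts_capped lE] ln; apply: F0 => ln'; exact: ln.
  - by move=> l [lE ln]; apply: capped_bparts => //; apply: leq_trans nM.
  - exact: uniq_bparts.
apply: fsbig_widen => [l []//|l [lE ln]] /=.
by apply: F0 => ln'; exact: ln.
Qed.

Lemma fps_sum_conj_part :
  \fps_sum_(l \in capped_parts pred0 0) (x ^+ alt_sum l * q ^+ sumn l) =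
  \fps_sum_(l \in capped_parts pred0 0) (x ^+ odd_parts l * q ^+ sumn l).
Proof.
apply/fpsP => n /=.
rewrite [RHS](reindex_fsbig conj_part (capped_parts pred0 0)).
  apply: eq_fsbigr => l; rewrite inE => -[lP _].
  by rewrite odd_parts_conj_part // sumn_conj_part.
split=> [l [lP _]|l l'|l [lP _]]; first by split=> //; exact: is_partition_conj.
  rewrite !inE => -[lP _] [l'P _] E.
  by rewrite -(conj_partK lP) E conj_partK.
exists (conj_part l); last exact: conj_partK.
by split=> //; exact: is_partition_conj.
Qed.

(** Splits off the factor [q ^+ M] that [fps_cvg_prod1] requires. *)
Lemma part_wt_exp_cap k M :
  part_wt x q k.+1 ^+ M.*2.+2 =
  x ^+ (odd k.+1 * M.*2.+2) * q ^+ (k.+1 * M.*2.+2 - M) * q ^+ M.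
Proof.
rewrite /part_wt exprMn -!exprM -mulrA -exprD; congr (_ * q ^+ _); nia.
Qed.

Lemma cap_prod_cvg_all :
  fps_cvg (fun M => cap_prod x q (cap pred0 0 M) M.*2) 1.
Proof.
rewrite /cap_prod /cap.
under eq_fun do under eq_bigr do rewrite part_wt_exp_cap.
exact: (fps_cvg_prod1 double (fun M k =>
  x ^+ (odd k.+1 * M.*2.+2) * q ^+ (k.+1 * M.*2.+2 - M))).
Qed.

(** The factors of parts [2i+1] and [2i+2] are paired. The odd ones, capped by [M], tend to 1; the
    even ones have exponent [(2i+2)(2m+2) = (4m+4)(i+1)] and form the Pochhammer product. *)
Lemma cap_prod_cvg_even m :
  fps_cvg (fun M => cap_prod x q (cap (fun k => ~~ odd k) m M) M.*2)
          (qpoch_inf (q ^+ (4 * m + 4)) (q ^+ (4 * m + 4))).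
Proof.
have -> : (fun M => cap_prod x q (cap (fun k => ~~ odd k) m M) M.*2) =
    fun M => \prod_(i < M) (1 - x ^+ M.*2.+2 *
                              q ^+ (i.*2.+1 * M.*2.+2 - M) * q ^+ M) *
             qpoch (q ^+ (4 * m + 4)) (q ^+ (4 * m + 4)) M.
  apply/funext => M; rewrite /cap_prod.
  rewrite (prod_double
    (fun i => 1 - part_wt x q i.+1 ^+ (cap _ m M i.+1).*2.+2)).
  rewrite big_split /=; congr (_ * _); apply: eq_bigr => i _; congr (1 - _).
    by rewrite /cap /= odd_double /= part_wt_exp_cap /= odd_double mul1n.
  rewrite /cap /part_wt /= odd_double /= expr0 mul1r -!exprM -exprD.
  by congr (q ^+ _); lia.
rewrite -[X in fps_cvg _ X]mul1r; apply: fps_cvgM.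
  exact: (fps_cvg_prod1 id (fun M i =>
    x ^+ M.*2.+2 * q ^+ (i.*2.+1 * M.*2.+2 - M))).
by apply: qpoch_cvg; rewrite fcoefXn addn4.
Qed.

Lemma part_wt_prod M :
  \prod_(i < M.*2) (1 - part_wt x q i.+1) =
  qpoch (x * q) (q ^+ 2) M * qpoch (q ^+ 2) (q ^+ 2) M.
Proof.
rewrite (prod_double (fun i => 1 - part_wt x q i.+1)) big_split.
congr (_ * _); apply: eq_bigr => i _; congr (1 - _);
  rewrite /part_wt /= odd_double -exprM mul2n.
  by rewrite expr1 [q ^+ _.+1]exprS mulrA.
by rewrite expr0 mul1r -exprD.
Qed.

(** Limit of [odd_gfE]: the denominators of odd and even parts give the two Pochhammer factors. *)
Lemma odd_gf_capped E m H :
  fps_cvg (fun M => cap_prod x q (cap E m M) M.*2) H ->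
  (\fps_sum_(l \in capped_parts E m) (x ^+ odd_parts l * q ^+ sumn l)) *
    (qpoch_inf (x * q) (q ^+ 2) * qpoch_inf (q ^+ 2) (q ^+ 2)) = H.
Proof.
have q20 : (q ^+ 2)@_0 = 0 by rewrite fcoefXn.
have gf_cvg := fps_cvgM (bparts_gf_cvg E m odd_parts)
  (fps_cvgM (qpoch_cvg (x * q) q20) (qpoch_cvg (q ^+ 2) q20)).
move=> cH; apply: (eq_fps_lim _ gf_cvg cH) => M.
by rewrite -part_wt_prod -odd_gfE.
Qed.

End CappedGeneratingFunctions.

(** * Comparison and closed form *)

(** Factorwise difference of squares; it trades [1/(xq;q^2)] for [(-xq;q^2)/(x^2q^2;q^4)]. *)
Lemma qpoch_inf_sqr (R : comNzRingType) (a Q : {fps R}) : Q@_0 = 0 ->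
  qpoch_inf a Q * qpoch_inf (- a) Q = qpoch_inf (a ^+ 2) (Q ^+ 2).
Proof.
move=> Q0; have Q20 : (Q ^+ 2)@_0 = 0 by rewrite fcoef0M Q0 mul0r.
apply: (eq_fps_lim _ (fps_cvgM (qpoch_cvg a Q0) (qpoch_cvg (- a) Q0))
  (qpoch_cvg (a ^+ 2) Q20)) => M.
rewrite /qpoch -big_split; apply: eq_bigr => i _ /=.
by rewrite -exprM mulnC exprM; ring.
Qed.

Lemma alt_gf_capped (R : comNzRingType) (x : {fps R}) m :
  let q := fpsX R in
  \fps_sum_(l \in Cset m) (x ^+ alt_sum l * q ^+ sumn l) =
  (\fps_sum_(l \in capped_parts pred0 0) (x ^+ alt_sum l * q ^+ sumn l)) *
    qpoch_inf (q ^+ (4 * m + 4)) (q ^+ (4 * m + 4)).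
Proof.
(* The inserted 1 is the limit of [cap_prod] for unrestricted partitions. *)
move=> q; rewrite -[LHS]mulr1.
apply: (eq_fps_lim (fun M => alt_gf_cap_prod x q
   (cap (fun k => ~~ odd k) m M) (cap pred0 0 M) M.*2));
  apply: fps_cvgM; try exact: bparts_gf_cvg.
- exact: cap_prod_cvg_all.
- exact: cap_prod_cvg_even.
Qed.

(** Used with [o] the odd-part series, [p = (xq;q^2)], [v = (q^2;q^2)] and [r = (-xq;q^2)]. *)
Lemma eq_mul_div (S : comUnitRingType) (o p v r : S) :
  v * (p * r) \is a GRing.unit -> o = r * (o * (p * v)) / (v * (p * r)).
Proof. by move=> u; apply: (canRL (mulrK u)); ring. Qed.

Theorem theorem3p4 (m : nat) :
  let x : {fps {poly int}} := fpsC 'X in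
  let q : {fps {poly int}} := fpsX {poly int} in
  \fps_sum_(l \in Cset m) (x ^+ alt_sum l * q ^+ sumn l)
    = \fps_sum_(l \in Cset m) (x ^+ odd_parts l * q ^+ sumn l)
  /\
  \fps_sum_(l \in Cset m) (x ^+ odd_parts l * q ^+ sumn l)
    = (qpoch_inf (- (x * q)) (q ^+ 2)
         * qpoch_inf (q ^+ (4 * m + 4)) (q ^+ (4 * m + 4)))
      / (qpoch_inf (q ^+ 2) (q ^+ 2)
         * qpoch_inf (x ^+ 2 * q ^+ 2) (q ^+ 4)).
Proof.
move=> x q.
have q20 : (q ^+ 2)@_0 = 0 by rewrite fcoefXn.
have O_all := odd_gf_capped (cap_prod_cvg_all x).
have O_m := odd_gf_capped (cap_prod_cvg_even x m).
split.
  (* By [O_all], the series over all partitions cancels the Pochhammer factors brought in by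
     [O_m]. *)
  by rewrite alt_gf_capped fps_sum_conj_part -O_m mulrCA O_all mulr1.
have sqr := qpoch_inf_sqr (x * q) q20; rewrite exprMn -exprM in sqr.
have x2q20 : (x ^+ 2 * q ^+ 2)@_0 = 0 by rewrite fcoef0M q20 mulr0.
have q40 : (q ^+ 4)@_0 = 0 by rewrite fcoefXn.
have VU := qpoch_inf_unit q20 q20; have XU := qpoch_inf_unit x2q20 q40.
rewrite -{}sqr in XU *; rewrite -{}O_m.
by apply: eq_mul_div; rewrite unitrM VU XU.
Qed.
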